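(* Let $p\in\mathbb{C}[z_1,z_2]$ be semi-stable and $q\in\mathcal{I}_p$. Then $q/p$ is non-tangentially bounded at every point of $\mathbb{T}^2$; equivalently, if $p$ vanishes to order $M$ at some point of $\mathbb{T}^2$, then every element of $\mathcal{I}_p$ vanishes to order at least $M$ at that point.
   Context: $\mathbb{D}$ is the open unit disk, $\mathbb{T}$ the unit circle. For $p$ of bidegree $(n,m)$, $\tilde p(z)=z_1^nz_2^m\overline{p(1/\bar z_1,1/\bar z_2)}$; $p$ is semi-stable if it has no zeros in $\mathbb{D}^2$ and $p,\tilde p$ have no common factor. $\mathcal{I}_p=\{q\in\mathbb{C}[z_1,z_2]:q/p\in L^2(\mathbb{T}^2)\}$. For $\lambda\in\mathbb{T}^2$ and $c>1$, $\Gamma_c(\lambda)$ is the set of $z\in\mathbb{D}^2$ for which any two of $|z_1-\lambda_1|,|z_2-\lambda_2|,1-|z_1|,1-|z_2|$ have ratio in $[1/c,c]$; $f$ is non-tangentially bounded at $\lambda$ if for every $c>1$, $f$ is bounded on $\Gamma_c(\lambda)$ near $\lambda$. Vanishing to order $M$ at a point means the lowest nonzero homogeneous term of the Taylor expansion there has degree $M$. *)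

(* Defs.v *)
From HB Require Import structures.
From mathcomp Require Import all_boot all_order all_algebra.
From mathcomp Require Import all_classical all_reals all_analysis.
From mathcomp Require Import measurable_realfun lebesgue_integral.
From mathcomp Require Import complex.
Set Implicit Arguments. Unset Strict Implicit. Unset Printing Implicit Defensive.
Import Order.TTheory GRing.Theory Num.Theory.
Local Open Scope ring_scope.
Import numFieldNormedType.Exports.
Local Open Scope classical_set_scope.

Section Bivariate.
Variable R : realType.
Local Notation C := R[i].

(* Polynomials in C[z1,z2] are represented as {poly {poly C}}:
   p = \sum_j p`_j(z1) z2^j, so that p`_j`_i is the coefficient of z1^i z2^j. *)
Definition peval2 (p : {poly {poly C}}) (z1 z2 : C) : C :=
  (map_poly (fun a : {poly C} => a.[z1]) p).[z2].

Definition cabs (z : C) : R := Num.sqrt (complex.Re z ^+ 2 + complex.Im z ^+ 2).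

Definition cconj (z : C) : C := Complex (complex.Re z) (- complex.Im z).

Definition degz2 (p : {poly {poly C}}) : nat := (size p).-1.
Definition degz1 (p : {poly {poly C}}) : nat := \max_(j < size p) (size (nth 0%R (polyseq p) j)).-1.

(* reflection  p~(z) = z1^n z2^m conj(p(1/conj z1, 1/conj z2)), written out on coefficients:
   p~ = \sum_{i<=n, j<=m} conj(a_{n-i, m-j}) z1^i z2^j *)
Definition reflect2 (p : {poly {poly C}}) : {poly {poly C}} :=
  \poly_(j < (degz2 p).+1) \poly_(i < (degz1 p).+1)
     cconj (p`_(degz2 p - j)`_(degz1 p - i)).

Definition in_disk (z : C) : Prop := cabs z < 1.
Definition on_circle (z : C) : Prop := cabs z = 1.

Definition pdivides (r p : {poly {poly C}}) : Prop := exists s, p = r * s.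

Definition no_common_factor (p q : {poly {poly C}}) : Prop :=
  forall r, pdivides r p -> pdivides r q -> exists c : C, r = (c%:P)%:P.

Definition semi_stable (p : {poly {poly C}}) : Prop :=
  (forall z1 z2, in_disk z1 -> in_disk z2 -> peval2 p z1 z2 != 0) /\
  no_common_factor p (reflect2 p).

Definition expi (t : R) : C := Complex (cos t) (sin t).

(* |q/p|^2 on T^2, parametrised by [0,2pi]^2 (division by 0 gives 0, which only
   happens on a null set since p <> 0) *)
Definition ratio_sq (q p : {poly {poly C}}) (t : R * R) : \bar R :=
  ((cabs (peval2 q (expi t.1) (expi t.2)) / cabs (peval2 p (expi t.1) (expi t.2))) ^+ 2)%:E.

Definition torus_dom : set (R * R) := `[0, 2 * pi]%classic `*` `[0, 2 * pi]%classic.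

Definition Ip (p q : {poly {poly C}}) : Prop :=
  measurable_fun torus_dom (ratio_sq q p) /\
  (\int[(@lebesgue_measure R \x @lebesgue_measure R)%E]_(t in torus_dom) ratio_sq q p t < +oo)%E.

Definition gamma_quantities (z1 z2 l1 l2 : C) : seq R :=
  [:: cabs (z1 - l1); cabs (z2 - l2); 1 - cabs z1; 1 - cabs z2].

Definition Gamma (c : R) (l1 l2 : C) (z1 z2 : C) : Prop :=
  in_disk z1 /\ in_disk z2 /\
  forall a b, a \in gamma_quantities z1 z2 l1 l2 -> b \in gamma_quantities z1 z2 l1 l2 ->
    c^-1 <= a / b <= c.

Definition nt_bounded (f : C -> C -> C) (l1 l2 : C) : Prop :=
  forall c : R, 1 < c ->
    exists delta : R, 0 < delta /\ exists B : R,
      forall z1 z2, Gamma c l1 l2 z1 z2 ->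
        cabs (z1 - l1) < delta -> cabs (z2 - l2) < delta ->
        cabs (f z1 z2) <= B.

(* Taylor expansion at (l1,l2): q(z1 + l1, z2 + l2); the coefficient of
   (z1-l1)^i (z2-l2)^j in q is (shift2 q l1 l2)`_j`_i *)
Definition shift2 (q : {poly {poly C}}) (l1 l2 : C) : {poly {poly C}} :=
  map_poly (fun a : {poly C} => a \Po ('X + l1%:P)) (q \Po ('X + (l2%:P)%:P)).

Definition taylor_coef (q : {poly {poly C}}) (l1 l2 : C) (i j : nat) : C :=
  (shift2 q l1 l2)`_j`_i.

Definition vanishes_at_least (q : {poly {poly C}}) (l1 l2 : C) (M : nat) : Prop :=
  forall i j : nat, (i + j < M)%N -> taylor_coef q l1 l2 i j = 0.

Definition vanishes_order (q : {poly {poly C}}) (l1 l2 : C) (M : nat) : Prop :=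
  vanishes_at_least q l1 l2 M /\
  exists i j : nat, (i + j = M)%N /\ taylor_coef q l1 l2 i j != 0.

End Bivariate.

(* Main.v *)
Require Import Defs.
From HB Require Import structures.
From mathcomp Require Import all_boot all_order all_algebra.
From mathcomp Require Import all_classical all_reals all_analysis.
From mathcomp Require Import measurable_realfun lebesgue_integral.
From mathcomp Require Import complex.
From mathcomp Require Import ring lra zify.
Import Order.TTheory GRing.Theory Num.Theory.
Import numFieldNormedType.Exports.
Local Open Scope ring_scope.

(** Suppose [p] vanishes to order [M] and [q] to order [k < M] at a point of the torus.
    On a cone of directions where the leading forms of both do not vanish,
    [|q / p|^2 >= c h^(2 (k - M)) >= c / h^2] at distance [h].  The cone contains the disjoint
    squares [2^-n S] (for a fixed small square [S]), of area of order [4^-n], and each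
    contributes at least a fixed amount to the integral, which therefore diverges.

    For the non-tangential bound, [|q| <= B r^M] at distance [r], so that a lower bound
    [|p| >= k r^M] on the approach region is needed.  The restriction of [p] to a complex
    line through a point [z] of the region has no zeros in a disk of radius comparable to
    [r]; factoring this one-variable polynomial gives a Harnack-type inequality bounding
    [|p(z)|] below by the value of [|p|] at a point at distance of order [r] in a direction
    where the leading form of [p] does not vanish. *)

(** * Rescaling a polynomial at a point *)

Section BlowUp.
Variable K : numFieldType.
Implicit Types (a : nat -> nat -> K) (D M : nat) (r w : K).

(* [r^-M] times the polynomial with coefficients [a] at [(r w1, r w2)], extended to [r = 0],
   where it gives the form of degree [M].  The truncated subtraction is harmless, as the
   terms with [i + j < M] are dropped. *)
Definition blowup a D M r w1 w2 : K :=
  \sum_(j < D) \sum_(i < D)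
     (if (i + j < M)%N then 0
      else a j i * r ^+ (i + j - M) * w1 ^+ i * w2 ^+ j).

Lemma blowupE a D M r w1 w2 :
  (forall i j, (i + j < M)%N -> a j i = 0) ->
  \sum_(j < D) \sum_(i < D) a j i * (r * w1) ^+ i * (r * w2) ^+ j =
  r ^+ M * blowup a D M r w1 w2.
Proof.
move=> a0; rewrite /blowup mulr_sumr; apply: eq_bigr => j _.
rewrite mulr_sumr; apply: eq_bigr => i _; case: ltnP => [/a0 ->|Mij].
  by rewrite !mul0r mulr0.
have rE : r ^+ i * r ^+ j = r ^+ M * r ^+ (i + j - M) by rewrite -!exprD subnKC.
rewrite !exprMn; transitivity (a j i * (r ^+ i * r ^+ j) * w1 ^+ i * w2 ^+ j); first by ring.
by rewrite rE; ring.
Qed.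

(** Continuity is joint in the scale and the direction, which makes lower bounds near a good
    direction uniform as [r] tends to [0]. *)
Lemma blowup_continuous a D M w1 w2 (e : K) : 0 < e ->
  exists2 d : K, 0 < d & forall r v1 v2,
    `|r| < d -> `|v1 - w1| < d -> `|v2 - w2| < d ->
    `|blowup a D M r v1 v2 - blowup a D M 0 w1 w2| < e.
Proof.
move=> e0.
have cX (f : K * K * K -> K) n x : {for x, continuous f} ->
    {for x, continuous (fun y => f y ^+ n)}.
  move=> cf; elim: n => [|n IH]; first exact: cvg_cst.
  rewrite (_ : (fun y => _) = (fun y => f y * f y ^+ n)); first exact: cvgM.
  by apply/funext => y; rewrite exprS.
have cS (I : Type) (s : seq I) (F : I -> K * K * K -> K) x :
    (forall i, {for x, continuous (F i)}) ->
    {for x, continuous (fun y => \sum_(i <- s) F i y)}.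
  move=> cF; elim: s => [|i s IH].
    rewrite (_ : (fun y => _) = cst 0); first exact: cvg_cst.
    by apply/funext => y; rewrite big_nil.
  rewrite (_ : (fun y => _) = (fun y => F i y + \sum_(i <- s) F i y)).
    by apply: cvgD; [exact: cF|exact: IH].
  by apply/funext => y; rewrite big_cons.
have c1 x : {for x, continuous (fun y : K * K * K => y.1.1)}.
  apply: (@continuous_comp _ _ _ fst fst); [exact: cvg_fst|exact: cvg_fst].
have c2 x : {for x, continuous (fun y : K * K * K => y.1.2)}.
  apply: (@continuous_comp _ _ _ fst snd); [exact: cvg_fst|exact: cvg_snd].
have c3 x : {for x, continuous (fun y : K * K * K => y.2)} by exact: cvg_snd.
have cG : {for (0, w1, w2), continuous (fun y : K * K * K => blowup a D M y.1.1 y.1.2 y.2)}.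
  apply: (cS) => j; apply: (cS) => i.
  rewrite /blowup; case: (i + j < M)%N; first exact: cvg_cst.
  apply: cvgM; last exact/cX/c3.
  apply: cvgM; last exact/cX/c2.
  apply: cvgM; last exact/cX/c1.
  exact: cvg_cst.
move/cvgrPdist_lt/(_ e e0) : cG => /nbhs_ballP[d /= d0 dP].
exists d => // r v1 v2 rd vd1 vd2; rewrite distrC.
apply: (dP (r, v1, v2)); split; first split => /=.
- by rewrite /ball /= sub0r normrN.
- by rewrite /ball /= distrC.
- by rewrite /ball /= distrC.
Qed.

Lemma blowup_bounded a D M (W : K) : 0 <= W ->
  exists2 B : K, 0 <= B & forall r w1 w2,
    `|r| <= 1 -> `|w1| <= W -> `|w2| <= W -> `|blowup a D M r w1 w2| <= B.
Proof.
move=> W0; exists (\sum_(j < D) \sum_(i < D) `|a j i| * W ^+ i * W ^+ j).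
  by do 2 (apply: sumr_ge0 => ? _); rewrite !mulr_ge0 ?exprn_ge0.
move=> r w1 w2 r1 w1W w2W.
apply: (le_trans (ler_norm_sum _ _ _)); apply: ler_sum => j _.
apply: (le_trans (ler_norm_sum _ _ _)); apply: ler_sum => i _.
case: ifP => _; first by rewrite normr0 !mulr_ge0 ?exprn_ge0.
rewrite !normrM !normrX; apply: ler_pM; rewrite ?mulr_ge0 ?exprn_ge0//.
  apply: ler_pM; rewrite ?mulr_ge0 ?exprn_ge0//.
    by rewrite ler_piMr// exprn_ile1.
  by rewrite lerXn2r// nnegrE.
by rewrite lerXn2r// nnegrE.
Qed.

End BlowUp.

(* Factoring into linear factors, each factor [s - x] with [|x| >= d] is at most
   [|x| (1 + |s| / d)]. *)
Lemma norm_horner_zero_free (K : numClosedFieldType) (f : {poly K}) (d s : K) (N : nat) :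
  0 < d -> (size f <= N.+1)%N -> (forall t, `|t| < d -> f.[t] != 0) ->
  `|f.[s]| <= `|f.[0]| * (1 + `|s| / d) ^+ N.
Proof.
move=> d0 sf nz.
have [rs fE] := closed_field_poly_normal f.
have f0 : f != 0.
  by apply: contraTneq (nz 0 _) => [->|]; rewrite ?horner0 ?eqxx// normr0.
have lf0 : lead_coef f != 0 by rewrite lead_coef_eq0.
have q1 : 1 <= 1 + `|s| / d by rewrite lerDl divr_ge0// ltW.
have srs : (size rs <= N)%N.
  by move: sf; rewrite fE size_scale// size_prod_XsubC.
have rsd x : x \in rs -> d <= `|x|.
  move=> xrs; rewrite real_leNgt ?normr_real ?gtr0_real//; apply/negP => /nz.
  rewrite fE hornerZ mulf_eq0 negb_or => /andP[_].
  by rewrite horner_prod prodf_seq_neq0 => /allP/(_ _ xrs); rewrite hornerXsubC subrr eqxx.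
(* There may be fewer than [N] roots; the base is at least [1], so raising the exponent to [N] only
   weakens the bound. *)
apply: (@le_trans _ _ (`|f.[0]| * (1 + `|s| / d) ^+ size rs)); last first.
  by rewrite ler_wpM2l// ler_weXn2l.
rewrite fE !hornerZ !normrM -mulrA ler_wpM2l// !horner_prod.
elim: rs rsd {fE srs} => [|x rs IH] rsd; first by rewrite !big_nil mulr1.
rewrite !big_cons !normrM /= exprS !hornerXsubC sub0r normrN mulrACA.
apply: ler_pM => //; last by apply: IH => y yrs; apply: rsd; rewrite inE yrs orbT.
apply: (le_trans (ler_normB _ _)).
rewrite addrC mulrDr mulr1 lerD2l mulrCA ler_peMr//.
by rewrite ler_pdivlMr// mul1r rsd// mem_head.
Qed.

(** * Taylor shifts, leading forms and restrictions to lines *)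

Section Bivariate.
Variable R : realType.
Local Notation C := R[i].
Implicit Types (p q : {poly {poly C}}) (z w l v : C).

Lemma normC_cabs z : `|z| = (cabs z)%:C%C.
Proof. exact: normc_def. Qed.

Lemma peval2_horner_map p z1 z2 : peval2 p z1 z2 = (map_poly (horner_eval z1) p).[z2].
Proof. by []. Qed.

(** A single bound for both variables makes evaluation a double sum over a square range, the shape
    of [blowup]. *)
Definition deg_bound p : nat := maxn (size p) (\max_(j < size p) size (p`_j)%R).

Lemma size_deg_bound p : (size p <= deg_bound p)%N.
Proof. exact: leq_maxl. Qed.

Lemma size_coef_deg_bound p j : (size (p`_j)%R <= deg_bound p)%N.
Proof.
have [jp|pj] := ltnP j (size p); last by rewrite nth_default// size_poly0.
rewrite leq_max; apply/orP; right.
exact: (@leq_bigmax _ (fun j : 'I_(size p) => size (p`_j)%R) (Ordinal jp)).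
Qed.

Lemma peval2E p z1 z2 :
  peval2 p z1 z2 = \sum_(j < deg_bound p) \sum_(i < deg_bound p) p`_j`_i * z1 ^+ i * z2 ^+ j.
Proof.
rewrite peval2_horner_map (@horner_coef_wide _ (deg_bound p)); last first.
  exact: leq_trans (size_poly _ _) (size_deg_bound p).
apply: eq_bigr => j _; rewrite coef_map /= /horner_eval -mulr_suml.
by congr (_ * _); rewrite (horner_coef_wide _ (size_coef_deg_bound p j)).
Qed.

Lemma peval2_shift q l1 l2 w1 w2 :
  peval2 (shift2 q l1 l2) w1 w2 = peval2 q (w1 + l1) (w2 + l2).
Proof.
rewrite !peval2_horner_map /shift2 -map_poly_comp.
rewrite (@eq_map_poly _ _ _ (horner_eval (w1 + l1))); last first.
  by move=> a /=; rewrite /horner_eval horner_comp !hornerE.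
rewrite map_comp_poly horner_comp; congr (_.[_]).
by rewrite rmorphD /= map_polyX map_polyC /= /horner_eval !hornerE.
Qed.

Definition leading_form q l1 l2 M w1 w2 : C :=
  blowup C (fun j i => taylor_coef q l1 l2 i j) (deg_bound (shift2 q l1 l2)) M 0 w1 w2.

Lemma peval2_blowup q l1 l2 M r w1 w2 : vanishes_at_least q l1 l2 M ->
  peval2 q (l1 + r * w1) (l2 + r * w2) =
  r ^+ M * blowup C (fun j i => taylor_coef q l1 l2 i j)
             (deg_bound (shift2 q l1 l2)) M r w1 w2.
Proof.
move=> qM; rewrite addrC [l2 + _]addrC -peval2_shift peval2E.
by apply: blowupE => i j ijM; exact: qM.
Qed.

Lemma peval2_upper q l1 l2 M (W : C) : vanishes_at_least q l1 l2 M -> 0 <= W ->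
  exists2 B : C, 0 <= B & forall r w1 w2, `|r| <= 1 -> `|w1| <= W -> `|w2| <= W ->
    `|peval2 q (l1 + r * w1) (l2 + r * w2)| <= B * `|r| ^+ M.
Proof.
move=> qM W0.
have [B B0 BP] := blowup_bounded C (fun j i => taylor_coef q l1 l2 i j)
  (deg_bound (shift2 q l1 l2)) M W W0.
exists B => // r w1 w2 r1 w1W w2W; rewrite (peval2_blowup _ _ _ _ _ _ _ qM) normrM normrX mulrC.
by rewrite ler_wpM2r ?exprn_ge0// BP.
Qed.

(** By continuity the blow-up keeps at least half the modulus of its limit, the leading form at
    [(w1, w2)]. *)
Lemma peval2_lower q l1 l2 M w1 w2 : vanishes_at_least q l1 l2 M ->
  leading_form q l1 l2 M w1 w2 != 0 ->
  exists2 c : C, 0 < c & exists2 d : C, 0 < d & forall r v1 v2,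
    `|r| < d -> `|v1 - w1| < d -> `|v2 - w2| < d ->
    c * `|r| ^+ M <= `|peval2 q (l1 + r * v1) (l2 + r * v2)|.
Proof.
move=> qM; set G0 := leading_form _ _ _ _ _ _ => G0n.
have c0 : 0 < `|G0| / 2 by rewrite divr_gt0// normr_gt0.
exists (`|G0| / 2) => //.
have [d d0 dP] := blowup_continuous C (fun j i => taylor_coef q l1 l2 i j)
  (deg_bound (shift2 q l1 l2)) M w1 w2 _ c0.
exists d => // r v1 v2 rd vd1 vd2; rewrite (peval2_blowup _ _ _ _ _ _ _ qM) normrM normrX mulrC.
rewrite ler_wpM2l ?exprn_ge0//.
have := dP _ _ _ rd vd1 vd2; rewrite -/(leading_form _ _ _ _ _ _) -/G0 => h.
set G := blowup _ _ _ _ _ _ _ in h *.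
have := lerB_dist G0 (G0 - G); rewrite subKr; apply: le_trans.
have half : `|G0| - `|G0| / 2 = `|G0| / 2 by rewrite {1}(splitr `|G0|) addrK.
by rewrite lerBrDr -lerBrDl half distrC ltW.
Qed.

(** Along [(l1, l2 * y)] each monomial of degree [M] gives its own power of [y], with its
    coefficient multiplied by a nonzero number. Hence all but finitely many [y] are good
    directions. *)
Lemma leading_form_neq0 q l1 l2 M : l1 != 0 -> l2 != 0 -> vanishes_order q l1 l2 M ->
  exists2 f : {poly C}, f != 0 & forall y, leading_form q l1 l2 M l1 (l2 * y) = f.[y].
Proof.
move=> l10 l20 [_ [i0 [j0 [ijM cn]]]].
pose D := deg_bound (shift2 q l1 l2).
pose f : {poly C} := \sum_(j < D) \sum_(i < D | (i + j == M)%N)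
   (taylor_coef q l1 l2 i j * l1 ^+ i * l2 ^+ j) *: 'X^j.
have tD i j : taylor_coef q l1 l2 i j != 0 -> (i < D)%N /\ (j < D)%N.
  rewrite /taylor_coef => h; split; rewrite ltnNge; apply: contra h => h.
    by rewrite (nth_default 0 (leq_trans (size_coef_deg_bound _ _) h)).
  by rewrite (nth_default 0 (leq_trans (size_deg_bound _) h)) coef0.
exists f.
  have [iD jD] := tD _ _ cn.
  suff : f`_j0 != 0 by apply: contraNneq => ->; rewrite coef0.
  rewrite coef_sum (bigD1 (Ordinal jD))//= coef_sum (bigD1 (Ordinal iD))/=; last exact/eqP.
  rewrite coefZ coefXn eqxx mulr1 !big1 ?addr0.
  - by rewrite !mulf_neq0// expf_neq0.
  - move=> j /negP jj; rewrite coef_sum big1// => i _; rewrite coefZ coefXn.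
    by case: eqP => [e|]; rewrite ?mulr0//; case: jj; apply/eqP/val_inj.
  - move=> i /andP[/eqP iM /negP ii]; case: ii; apply/eqP/val_inj => /=.
    by move: iM ijM => /= <- /addIn ->.
move=> y; rewrite /leading_form /blowup -/D /f horner_sum.
apply: eq_bigr => j _; rewrite horner_sum [RHS]big_mkcond /=; apply: eq_bigr => i _.
(* Terms of degree below [M] are dropped by [blowup], those above [M] carry a positive power of [0],
   and those of degree [M] carry [0 ^+ 0 = 1]. *)
case: ltngtP => h; rewrite ?hornerE//.
  by rewrite expr0n subn_eq0 leqNgt h/= mulr0 !mul0r.
by rewrite h subnn expr0 mulr1 exprMn !mulrA ?hornerXn.
Qed.

Lemma exists_vanishes_order q l1 l2 i j : taylor_coef q l1 l2 i j != 0 ->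
  exists2 k, (k <= i + j)%N & vanishes_order q l1 l2 k.
Proof.
move=> cn.
pose P n := [exists i : 'I_n.+1, taylor_coef q l1 l2 i (n - i) != 0].
have PI i' j' : taylor_coef q l1 l2 i' j' != 0 -> P (i' + j')%N.
  move=> h; have ii : (i' < (i' + j').+1)%N by rewrite ltnS leq_addr.
  by apply/existsP; exists (Ordinal ii) => /=; rewrite addKn.
have ex : exists n, P n by exists (i + j)%N; exact: PI.
case: (ex_minnP ex) => k Pk kmin; exists k; first exact/kmin/PI.
split.
  move=> i' j'; apply: contraTeq => /PI/kmin; by rewrite leqNgt.
case/existsP: Pk => i' h; exists i', (k - i')%N; split=> //.
by rewrite subnKC// -ltnS.
Qed.

Lemma exists_vanishes_order_of_neq0 p l1 l2 z1 z2 : peval2 p z1 z2 != 0 ->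
  exists M, vanishes_order p l1 l2 M.
Proof.
rewrite -(subrK l1 z1) -(subrK l2 z2) -peval2_shift peval2E => h.
have [i [j c0]] : exists i j, taylor_coef p l1 l2 i j != 0.
  apply: contrapT => /forallNP h'; move: h; rewrite big1 ?eqxx// => j _.
  rewrite big1// => i _; move/forallNP : (h' i) => /(_ j)/negP; rewrite negbK => /eqP.
  by rewrite /taylor_coef => ->; rewrite !mul0r.
by have [M _ MP] := exists_vanishes_order _ _ _ _ _ c0; exists M.
Qed.

Definition restrict_line p z1 v1 z2 v2 : {poly C} :=
  (map_poly (fun a : {poly C} => a \Po (z1%:P + v1 *: 'X)) p).[z2%:P + v2 *: 'X].

Lemma horner_restrict_line p z1 v1 z2 v2 s :
  (restrict_line p z1 v1 z2 v2).[s] = peval2 p (z1 + v1 * s) (z2 + v2 * s).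
Proof.
rewrite /restrict_line -[LHS]/(horner_eval s _) -horner_map -map_poly_comp /=.
rewrite peval2_horner_map /horner_eval !hornerE; congr (_.[_]).
by apply: eq_map_poly => a /=; rewrite horner_comp !hornerE.
Qed.

(** The bound is independent of the line, so the constant in the Harnack-type inequality is uniform
    over the approach region. *)
Lemma size_restrict_line p z1 v1 z2 v2 :
  (size (restrict_line p z1 v1 z2 v2) <= (2 * deg_bound p).+2)%N.
Proof.
have sL z v : (size (z%:P + v *: 'X : {poly C})%R <= 2)%N.
  rewrite (leq_trans (size_polyD _ _))// geq_max (leq_trans (size_polyC_leq1 _))//=.
  by rewrite (leq_trans (size_scale_leq _ _))// size_polyX.
rewrite /restrict_line (@horner_coef_wide _ (deg_bound p)); last first.
  exact: leq_trans (size_poly _ _) (size_deg_bound p).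
apply: (leq_trans (size_sum _ _ _)); apply/bigmax_leqP => j _.
apply: (leq_trans (size_polyMleq _ _)).
have h1 : (size ((map_poly (fun a : {poly C} => a \Po (z1%:P + v1 *: 'X)) p)`_j)%R
           <= (deg_bound p).+1)%N.
  rewrite coef_map_id0 ?comp_poly0//.
  apply: (leq_trans (size_comp_poly_leq _ _)); rewrite ltnS.
  apply: (@leq_trans ((size (p`_j)%R) * 1)%N); last by rewrite muln1 size_coef_deg_bound.
  by rewrite leq_mul ?leq_pred// -ltnS (leq_trans (leqSpred _))//; have := sL z1 v1; case: size.
have h2 : (size ((z2%:P + v2 *: 'X : {poly C}) ^+ j)%R <= (deg_bound p).+1)%N.
  apply: (leq_trans (size_poly_exp_leq _ _)); rewrite ltnS.
  have := sL z2 v2; have := ltn_ord j; case: size => [|[|[|]]]//=; lia.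
by move: h1 h2; move: (size _) (size _) => a b; lia.
Qed.

End Bivariate.

(** * Angular parametrization of the circle *)

Section Angles.
Variable R : realType.
Local Notation C := R[i].

Lemma cos_sin_near0 (e : R) : 0 < e ->
  exists2 d : R, 0 < d & forall t, `|t| < d ->
    `|cos t - 1| <= e * `|t| /\ `|sin t - t| <= e * `|t|.
Proof.
move=> e0.
have der (f : R -> R) (l : R) : is_derive (0 : R) 1 f l ->
    exists2 d : R, 0 < d & forall t, `|t| < d -> `|f t - f 0 - l * t| <= e * `|t|.
  move=> [df fl].
  have : (h^-1 *: (f (h *: 1 + 0) - f 0) @[h --> 0^'] --> l)%classic.
    by rewrite -fl; apply: cvg_toP.
  move/cvgrPdist_le/(_ e e0); rewrite near_withinE => /nbhs_ballP[d /= d0 dP].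
  exists d => // t td; have [->|t0] := eqVneq t 0.
    by rewrite normr0 !mulr0 !subr0 subrr normr0.
  have := dP t; rewrite /ball /= sub0r normrN => /(_ td t0).
  rewrite addr0 /GRing.scale /= mulr1 => h.
  have -> : f t - f 0 - l * t = - (l - t^-1 * (f t - f 0)) * t by field.
  by rewrite normrM normrN ler_wpM2r.
have [d1 d10 h1] := der _ _ (is_derive_cos 0).
have [d2 d20 h2] := der _ _ (is_derive_sin 0).
exists (Num.min d1 d2); first by rewrite lt_min d10.
move=> t; rewrite lt_min => /andP[/h1 H1 /h2 H2].
by move: H1 H2; rewrite sin0 cos0 oppr0 mul0r !subr0 mul1r addr0.
Qed.

Lemma expiD (s t : R) : expi (s + t) = expi s * expi t.
Proof. by rewrite /expi cosD sinD; simpc; congr (_ +i* _)%C; ring. Qed.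

(** The strict bound [t < 2 * pi] leaves room to increase the angle inside [[0, 2 * pi]], so a cone
    of positive directions fits in [torus_dom] even at the angle [0]. *)
Lemma on_circle_expi (l : C) : on_circle l ->
  exists2 t : R, 0 <= t < 2 * pi & l = expi t.
Proof.
case: l => x y; rewrite /on_circle /cabs /= => h.
have xy : x ^+ 2 + y ^+ 2 = 1.
  by rewrite -[LHS]sqr_sqrtr ?addr_ge0 ?sqr_ge0// h expr1n.
have x1 : -1 <= x <= 1 by nra.
have pi0 := pi_gt0 R.
have [y0|y0] := leP 0 y.
  exists (acos x).
    by rewrite acos_ge0//=; have := acos_lepi x1; lra.
  rewrite /expi acosK ?in_itv//= sin_acos//; congr Complex.
  by rewrite (_ : 1 - _ = y ^+ 2) ?sqrtr_sqr ?ger0_norm//; lra.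
have x1' : -1 <= x < 1 by nra.
exists (- acos x + pi *+ 2).
  by have := acos_gt0 x1'; have := acos_lepi x1; rewrite mulr2n; lra.
rewrite /expi cosD2pi sinD2pi cosN sinN acosK ?in_itv//= sin_acos//; congr Complex.
by rewrite (_ : 1 - _ = y ^+ 2) ?sqrtr_sqr ?ltr0_norm ?opprK//; lra.
Qed.

(* The chord factor is ['i h] rather than [h], so that the rescaled tangent direction
   at the point [expi a] is radial. *)
Lemma expi_blowup (Y d : R) : 0 < Y -> 0 < d ->
  exists2 h0 : R, 0 < h0 & forall a h x : R, 0 < h < h0 -> `|x| <= Y ->
    exists2 w : C, expi (a + h * x) = expi a + ('i%C * h%:C%C) * (expi a * w)
                 & `|w - x%:C%C| < d%:C%C.
Proof.
move=> Y0 d0.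
(* With this tolerance the errors of cosine and sine, divided by [h], are each at most [d / 4],
   since [|x| <= Y]. *)
have e0 : 0 < d / (4 * Y) by rewrite divr_gt0// mulr_gt0.
have [d1 d10 H] := cos_sin_near0 _ e0.
exists (d1 / Y); first by rewrite divr_gt0.
move=> a h x /andP[h0 hd] xY.
have hx : `|h * x| < d1.
  rewrite normrM (gtr0_norm h0) (le_lt_trans (ler_wpM2l (ltW h0) xY))//.
  by rewrite -ltr_pdivlMr.
have [Hc Hs] := H _ hx.
have hn : h != 0 by rewrite gt_eqF.
(* This is [(expi (h * x) - 1) / ('i h)] in real and imaginary parts. *)
exists (Complex (sin (h * x) / h) (- ((cos (h * x) - 1) / h))).
  rewrite expiD /expi; simpc; congr Complex; field; exact: hn.
have bnd u : `|u| <= d / (4 * Y) * `|h * x| -> `|u / h| <= d / 4.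
  move=> hu; rewrite normrM normfV (gtr0_norm h0) ler_pdivrMr//.
  rewrite (_ : d / 4 * h = d / (4 * Y) * (h * Y)); last by field; rewrite gt_eqF.
  apply: (le_trans hu); rewrite ler_pM2l// normrM (gtr0_norm h0).
  exact: ler_wpM2l (ltW h0) _ _ xY.
apply: (@le_lt_trans _ _ ((d / 4)%:C + (d / 4)%:C)%C).
  set w := (X in `|X|).
  have -> : w = ((sin (h * x) - h * x) / h)%:C%C
       + Complex 0 (- ((cos (h * x) - 1) / h)).
    by rewrite /w; simpc; congr Complex; field; exact: hn.
  apply: (le_trans (ler_normD _ _)).
  by apply: lerD; rewrite normc_def /= expr0n /= ?addr0 ?add0r ?sqrrN sqrtr_sqr lecR bnd.
by rewrite -rmorphD /= ltcR; lra.
Qed.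

End Angles.

(** * Divergence of the integral over shrinking squares *)

Lemma integral_eq_pinfty_of_inverse_square (R : realType) (f : R * R -> \bar R) (D : set (R * R))
    (a b y eta h0 c : R) :
  measurable D -> measurable_fun D f -> (forall t, D t -> (0 <= f t)%E) ->
  0 < c -> 0 < h0 -> 0 < eta -> eta < 1 / 3 ->
  (forall h x1 x2, 0 < h < h0 -> `|x1 - 1| < eta -> `|x2 - y| < eta ->
     D (a + h * x1, b + h * x2) /\ ((c / h ^+ 2)%:E <= f (a + h * x1, b + h * x2)%R)%E) ->
  (\int[(@lebesgue_measure R \x @lebesgue_measure R)%E]_(t in D) f t = +oo)%E.
Proof.
move=> mD mf f0 c0 h00 eta0 eta3 H.
pose h n : R := h0 / 2 ^+ n.+1.
have hgt0 n : 0 < h n by rewrite divr_gt0// exprn_gt0.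
have hlt n : h n < h0.
  by rewrite /h ltr_pdivrMr ?exprn_gt0// ltr_pMr// exprn_egt1// ltr1n.
have hhalf m n : (m < n)%N -> h n <= h m / 2.
  move=> mn; rewrite /h -mulrA -invfM -exprSr ler_pM2l// lef_pV2 ?posrE ?exprn_gt0//.
  by rewrite ler_weXn2l// ler1n.
pose I (s : R) n (x : R) : set R := `]s + h n * (x - eta), s + h n * (x + eta)[%classic.
have IP s n x t : I s n x t -> exists2 u : R, t = s + h n * u & `|u - x| < eta.
  rewrite /I /= in_itv /= => /andP[t1 t2]; exists ((t - s) / h n).
    by rewrite mulrC divfK ?gt_eqF// addrC subrK.
  by rewrite ltr_distl ltr_pdivlMr// ltr_pdivrMr// !(mulrC _ (h n)); lra.
pose F n : set (R * R) := (I a n 1%R `*` I b n y)%classic.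
have mF n : measurable (F n) by apply: measurableX; exact: measurable_itv.
have FH n t : F n t -> D t /\ ((c / h n ^+ 2)%:E <= f t)%E.
  case: t => t1 t2 [/= /IP[u1 -> hu1] /IP[u2 -> hu2]].
  by apply: H => //; rewrite hgt0 hlt.
have FD n : (F n `<=` D)%classic by move=> t /FH[].
(* The first coordinates already separate the squares: [h n * (1 + eta) <= h m / 2 * (1 + eta) < h m
   * (1 - eta)], the last inequality being [eta < 1 / 3]. *)
have disj m n t : (m < n)%N -> F m t -> F n t -> False.
  move=> mn [/= + _] [/= + _]; rewrite /I /= !in_itv /= => /andP[tm _] /andP[_ tn].
  have := hhalf _ _ mn; have := hgt0 m; nra.
have tF : trivIset setT F.
  move=> m n _ _ [t [Fm Fn]]; case: (ltngtP m n) => // mn.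
    by case: (disj _ _ _ mn Fm Fn).
  by case: (disj _ _ _ mn Fn Fm).
have muF n : ((@lebesgue_measure R \x @lebesgue_measure R) (F n) =
    ((2 * eta * h n) * (2 * eta * h n))%:E)%E.
  rewrite product_measure1E; [|exact: measurable_itv..].
  have lI s x : (lebesgue_measure (I s n x) = (2 * eta * h n)%:E)%E.
    rewrite /I lebesgue_measure_itv /= lte_fin.
    have := hgt0 n => hn0.
    rewrite ifT; last by rewrite ltrD2l ltr_pM2l//; lra.
    by rewrite -EFinD; congr EFin; ring.
  by rewrite EFinM; congr (_ * _)%E; exact: lI.
(* The area [(2 * eta * h n) ^+ 2] cancels the factor [h n ^+ 2] in the lower bound of [f], so the
   contribution does not depend on [n]. *)
have intF n : ((4 * c * eta ^+ 2)%:E <=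
    \int[(@lebesgue_measure R \x @lebesgue_measure R)%E]_(t in F n) f t)%E.
  have -> : ((4 * c * eta ^+ 2)%:E =
      \int[(@lebesgue_measure R \x @lebesgue_measure R)%E]_(t in F n) (c / h n ^+ 2)%:E)%E.
    transitivity ((c / h n ^+ 2)%:E * ((2 * eta * h n) * (2 * eta * h n))%:E)%E; last first.
      rewrite integral_cst; last exact: mF.
      by congr (_ * _)%E; exact: esym (muF n).
    rewrite -EFinM; congr EFin.
    by field; rewrite gt_eqF.
  apply: ge0_le_integral.
  - exact: mF.
  - by move=> t _; rewrite lee_fin divr_ge0// ?ltW// exprn_gt0.
  - exact: measurable_cst.
  - exact: measurable_funS mD (FD n) mf.
  - by move=> t /FH[].
apply/eqyP => A A0.
(* Enough squares for their total contribution to exceed [A]. *)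
pose N := (Num.truncn (A / (4 * c * eta ^+ 2))).+1.
have k0 : 0 < 4 * c * eta ^+ 2 by rewrite !mulr_gt0// exprn_gt0.
apply: (@le_trans _ _ (\sum_(0 <= n < N) (4 * c * eta ^+ 2)%:E)%E).
  rewrite sumEFin lee_fin sumr_const_nat subn0 -[leRHS]mulr_natl -ler_pdivrMr//.
  by rewrite ltW// truncnS_gt.
apply: (@le_trans _ _ (\sum_(0 <= n < N)
    \int[(@lebesgue_measure R \x @lebesgue_measure R)%E]_(t in F n) f t)%E).
  by apply: lee_sum => n _; exact: intF.
have UD : (\bigcup_n F n `<=` D)%classic by apply: bigcup_sub => n _; exact: FD.
apply: (@le_trans _ _ (\int[(@lebesgue_measure R \x @lebesgue_measure R)%E]_(t in
    (\bigcup_n F n)%classic) f t)%E).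
  rewrite ge0_integral_bigcup//.
  - apply: nneseries_lim_ge => n _ _; apply: integral_ge0 => t Ft.
    exact/f0/FD/Ft.
  - exact: measurable_funS mf.
  - by move=> t /UD /f0.
by apply: ge0_subset_integral => //; exact: bigcupT_measurable.
Qed.

(** * Lower bound for [p] on approach regions *)

Section Main.
Variable R : realType.
Local Notation C := R[i].
Implicit Types (p q : {poly {poly C}}) (z w l v : C).

Lemma gt0_real_complex (x : C) : 0 < x -> exists2 r : R, 0 < r & x = r%:C%C.
Proof.
case: x => a b; rewrite ltcE /= => /andP[/eqP -> a0]; by exists a.
Qed.

(** A good direction is sought among the positive integers because it must be real to be tangent to
    the torus, and positive so that both angles increase. *)
Lemma exists_nat_nonroot (f : {poly C}) : f != 0 -> exists n : nat, f.[n.+1%:R] != 0.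
Proof.
move=> f0; apply: contrapT => /forallNP h.
suff: (size f < size f)%N by rewrite ltnn.
rewrite -[X in (X < _)%N](size_iota 0) -(size_map (fun n => n.+1%:R : C)).
apply: max_poly_roots => //.
  by apply/allP => x /mapP[n _ ->]; apply/negPn/negP; exact: h.
rewrite map_inj_uniq ?iota_uniq// => m n /eqP.
by rewrite eqr_nat eqSS => /eqP.
Qed.

Lemma normr_on_circle l : on_circle l -> `|l| = 1.
Proof. by move=> h; rewrite normC_cabs h. Qed.

Lemma on_circle_neq0 l : on_circle l -> l != 0.
Proof. by move/normr_on_circle => h; rewrite -normr_eq0 h oner_eq0. Qed.

Lemma Gamma_bounds (c : R) l1 l2 z1 z2 : 1 < c -> Gamma c l1 l2 z1 z2 ->
  [/\ 0 < `|z1 - l1|, `|z2 - l2| <= c%:C%C * `|z1 - l1|,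
      `|z1 - l1| <= c%:C%C * (1 - `|z1|) & `|z1 - l1| <= c%:C%C * (1 - `|z2|)].
Proof.
move=> c1 [d1 [d2 H]]; have c0 : 0 < c by lra.
rewrite !normC_cabs.
set a := cabs (z1 - l1) in H *; set b := cabs (z2 - l2) in H *.
have aG : a \in gamma_quantities z1 z2 l1 l2 by rewrite inE eqxx.
(* If [a] were [0], the ratio [a / a] would be [0] by the convention for division, contradicting the
   lower bound [c^-1]. *)
have a0 : 0 < a.
  rewrite lt_neqAle sqrtr_ge0 andbT eq_sym; apply/eqP => a0.
  have := H a a aG aG; rewrite a0 mul0r => /andP[+ _].
  by rewrite invr_le0 leNgt c0.
have le (u v : R) : u \in gamma_quantities z1 z2 l1 l2 ->
    v \in gamma_quantities z1 z2 l1 l2 -> 0 < v -> u <= c * v.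
  by move=> uG vG v0; have /andP[_] := H u v uG vG; rewrite ler_pdivrMr.
split; rewrite -?rmorph1 -?rmorphB -?rmorphM /= ?ltcR ?lecR//.
- by apply: le => //; rewrite !inE eqxx ?orbT.
- by apply: le => //; rewrite ?inE ?eqxx ?orbT// subr_gt0.
- by apply: le => //; rewrite ?inE ?eqxx ?orbT// subr_gt0.
Qed.

(* The segment from [z] to the point [l + r w], with [w] a direction on which the leading
   form of [p] does not vanish, has length comparable to the distance from [z] to the
   boundary of the bidisk, so [norm_horner_zero_free] transports the lower bound at
   [l + r w] to [z]. *)
Lemma Gamma_lower p l1 l2 M (c : R) :
  (forall z1 z2, in_disk z1 -> in_disk z2 -> peval2 p z1 z2 != 0) ->
  on_circle l1 -> on_circle l2 -> vanishes_order p l1 l2 M -> 1 < c ->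
  exists2 d : C, 0 < d & exists2 k : C, 0 < k & forall z1 z2,
    Gamma c l1 l2 z1 z2 -> `|z1 - l1| < d -> k * `|z1 - l1| ^+ M <= `|peval2 p z1 z2|.
Proof.
move=> pD cl1 cl2 pM c1.
have [f f0 fE] := leading_form_neq0 _ _ _ _ _ (on_circle_neq0 _ cl1) (on_circle_neq0 _ cl2) pM.
have [n fn] := exists_nat_nonroot _ f0; rewrite -fE in fn.
have [k k0 [d d0 low]] := peval2_lower _ _ _ _ _ _ _ (proj1 pM) fn.
pose y : C := n.+1%:R; pose c' : C := c%:C%C; pose K : C := 1 + y + c'.
have c'1 : 1 < c' by rewrite -[1](rmorph1 (real_complex R)) ltcR.
have c'0 : 0 < c' by exact: lt_trans c'1.
have y0 : 0 < y by rewrite ltr0n.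
have K0 : 0 < K by rewrite !addr_gt0.
(* Both increments [v1], [v2] below are at most [K * r], so a parameter of modulus less than [del]
   moves each coordinate by less than [r / c'], which is at most its distance to the circle. *)
pose del : C := (c' * K)^-1.
have del0 : 0 < del by rewrite invr_gt0 mulr_gt0.
pose N := (2 * deg_bound R p).+1.
pose A : C := (1 + `|1| / del) ^+ N.
have A0 : 0 < A by rewrite exprn_gt0// addr_gt0// divr_gt0// normr1.
exists d => //; exists (k / A); first by rewrite divr_gt0.
move=> z1 z2 /(Gamma_bounds _ _ _ _ _ c1); set r := `|z1 - l1|.
move=> [r0 z2r rz1 rz2] rd.
(* The endpoint at parameter [1] lies outside the closed bidisk. This is harmless: zero-freeness is
   used only for parameters below [del], and the lower bound at the endpoint comes from the leading
   form. *)
pose v1 := l1 + r * l1 - z1; pose v2 := l2 + r * (l2 * y) - z2.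
have v1K : `|v1| <= K * r.
  have -> : v1 = r * l1 - (z1 - l1) by rewrite /v1; ring.
  apply: (le_trans (ler_normB _ _)); rewrite -/r normrM (normr_on_circle _ cl1) mulr1.
  rewrite /r normr_id -/r -mulr2n -mulr_natl ler_wpM2r ?ltW// /K -addrA.
  by rewrite -[ltLHS]/(1 + 1) ltrD2l (lt_trans c'1)// ltrDr.
have v2K : `|v2| <= K * r.
  have -> : v2 = r * (l2 * y) - (z2 - l2) by rewrite /v2; ring.
  apply: (le_trans (ler_normB _ _)); rewrite !normrM (normr_on_circle _ cl2) mul1r.
  rewrite (gtr0_norm y0) (gtr0_norm r0) (le_trans (lerD (lexx _) z2r))// mulrC -mulrDl.
  by rewrite ler_wpM2r ?ltW// /K -addrA ltrDr.
have inD z v t : `|v| <= K * r -> r <= c' * (1 - `|z|) -> `|t| < del -> in_disk (z + v * t).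
  move=> vK rz td; suff : `|z + v * t| < 1.
    by rewrite normC_cabs -[1](rmorph1 (real_complex R)) ltcR.
  apply: (le_lt_trans (ler_normD _ _)); rewrite -ltrBrDl normrM.
  apply: (@lt_le_trans _ _ (K * r * del)).
    apply: (@le_lt_trans _ _ (K * r * `|t|)); first by rewrite ler_wpM2r.
    by rewrite ltr_pM2l// mulr_gt0.
  rewrite /del invfM [c'^-1 * _]mulrC mulrA (mulrC K) mulfK ?gt_eqF//.
  by rewrite ler_pdivrMr// mulrC.
have nz t : `|t| < del -> (restrict_line R p z1 v1 z2 v2).[t] != 0.
  by move=> td; rewrite horner_restrict_line; apply: pD; exact: inD.
have := norm_horner_zero_free _ _ _ 1 N del0 (size_restrict_line _ _ _ _ _ _) nz.
rewrite !horner_restrict_line !mulr1 !mulr0 !addr0 -/A.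
rewrite /v1 /v2 ![_ + (_ - _)]addrC !subrK => har.
rewrite mulrAC ler_pdivrMr//; apply: le_trans har.
by have := low r l1 (l2 * y); rewrite !subrr normr0 {1 2}/r !normr_id; apply.
Qed.

Lemma nt_bounded_of_vanishes p q l1 l2 M :
  (forall z1 z2, in_disk z1 -> in_disk z2 -> peval2 p z1 z2 != 0) ->
  on_circle l1 -> on_circle l2 -> vanishes_order p l1 l2 M ->
  vanishes_at_least q l1 l2 M ->
  nt_bounded (fun z1 z2 => peval2 q z1 z2 / peval2 p z1 z2) l1 l2.
Proof.
move=> pD cl1 cl2 pM qM c c1.
have [d d0 [k k0 low]] := Gamma_lower _ _ _ _ _ pD cl1 cl2 pM c1.
have c0 : (0 : C) <= c%:C%C by rewrite ler0c; lra.
have [B B0 up] := peval2_upper _ _ _ _ _ _ qM c0.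
have [d' d'0 dE] := gt0_real_complex _ d0.
exists (Num.min d' 1); split; first by rewrite lt_min d'0 ltr01.
(* [B] may be [0]; [B + 1] keeps the constant positive. *)
have Bk : 0 < (B + 1) / k by rewrite divr_gt0// ltr_wpDl.
have [B' B'0 BE] := gt0_real_complex _ Bk.
exists B' => z1 z2 zG; rewrite lt_min => /andP[zd z1'] _.
have [r0 z2r _ _] := Gamma_bounds _ _ _ _ _ c1 zG.
have rd : `|z1 - l1| < d by rewrite normC_cabs dE ltcR.
have r1 : `|z1 - l1| <= 1.
  by rewrite normC_cabs -[1](rmorph1 (real_complex R)) lecR ltW.
have {}low := low _ _ zG rd.
set r := `|z1 - l1| in r0 z2r rd r1 low.
have rn : r != 0 by rewrite gt_eqF.
have nr : `|r| = r by exact: gtr0_norm.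
rewrite -lecR -normC_cabs -BE normrM normfV.
have rM0 : 0 < r ^+ M by rewrite exprn_gt0.
have p0 : 0 < `|peval2 p z1 z2| by apply: lt_le_trans low; rewrite mulr_gt0.
(* At scale [r] these directions have moduli [1] and at most [c], which is why [up] was taken with
   the bound [c]. *)
have := up r ((z1 - l1) / r) ((z2 - l2) / r).
rewrite ![r * (_ / r)]mulrC !divfK// ![_ + (_ - _)]addrC !subrK nr.
rewrite !normrM !normfV nr -/r divff// ler_pdivrMr// => {}up.
have c1' : 1 <= c%:C%C by rewrite -[1](rmorph1 (real_complex R)) lecR ltW.
rewrite ler_pdivrMr//; apply: (le_trans (up r1 c1' z2r)).
apply: (@le_trans _ _ ((B + 1) * r ^+ M)).
  by rewrite ler_wpM2r ?ltW// ltrDl ltr01.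
by rewrite -mulrA ler_pM2l ?ltr_wpDl// ler_pdivlMl.
Qed.

(** * Order of vanishing forced by square-integrability *)

Lemma vanishes_of_Ip p q l1 l2 M : Ip p q -> on_circle l1 -> on_circle l2 ->
  vanishes_order p l1 l2 M -> vanishes_at_least q l1 l2 M.
Proof.
move=> [mq intq] cl1 cl2 pM i j ijM; apply/eqP; apply: contraT => qij.
have [k kij qk] := exists_vanishes_order _ _ _ _ _ _ qij.
have kM : (k < M)%N by exact: leq_ltn_trans ijM.
have [l10 l20] := (on_circle_neq0 _ cl1, on_circle_neq0 _ cl2).
have [f f0 fE] := leading_form_neq0 _ _ _ _ _ l10 l20 pM.
have [g g0 gE] := leading_form_neq0 _ _ _ _ _ l10 l20 qk.
(* A nonroot of the product is a direction good for [p] and [q] at once. *)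
have [n] := exists_nat_nonroot _ (mulf_neq0 f0 g0).
rewrite hornerM mulf_eq0 negb_or -fE -gE => /andP[fn gn] {f f0 fE g g0 gE}.
have [kp kp0 [dp dp0 lowp]] := peval2_lower _ _ _ _ _ _ _ (proj1 pM) fn.
have [kq kq0 [dq dq0 lowq]] := peval2_lower _ _ _ _ _ _ _ (proj1 qk) gn.
pose y : R := n.+1%:R; have y0 : 0 < y by rewrite ltr0n.
have yE : (n.+1%:R : C) = y%:C%C by rewrite rmorph_nat.
rewrite yE in lowp lowq.
have W0 : 0 <= (y + 2)%:C%C :> C by rewrite ler0c addr_ge0// ltW.
have [B B0 up] := peval2_upper _ _ _ _ _ _ (proj1 pM) W0.
have [dp' dp'0 dpE] := gt0_real_complex _ dp0.
have [dq' dq'0 dqE] := gt0_real_complex _ dq0.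
(* This is the constant [e] in [|q / p| >= e / h]: the lower constant of [q] over the upper constant
   of [p]. *)
have B10 : 0 < kq / (B + 1) by rewrite divr_gt0// ltr_wpDl.
have [e e0 eE] := gt0_real_complex _ B10.
have [a /andP[a0 a2] aE] := on_circle_expi _ _ cl1.
have [b /andP[b0 b2] bE] := on_circle_expi _ _ cl2.
have [d [d0 d1 ddp ddq]] : exists d : R, [/\ 0 < d, d <= 1, d <= dp' & d <= dq'].
  exists (Num.min (Num.min dp' dq') 1).
  by rewrite !lt_min !ge_min dp'0 dq'0 ltr01 !lexx !orbT.
have Y0 : 0 < y + 1 by rewrite addr_gt0.
(* Half of the tolerance [d] goes to the curvature of the circle, the other half covers the
   deviation [eta = d / 4] of the direction. *)
have [h1 h10 arc] := expi_blowup _ _ (d / 2) Y0 (divr_gt0 d0 (ltr0n _ 2)).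
have ang0 (t : R) : t < 2 * pi -> 0 < (2 * pi - t) / (y + 1).
  by move=> t2; rewrite divr_gt0// subr_gt0.
(* The last two terms keep the angles [a + h * x1] and [b + h * x2] at most [2 * pi], as [x1] and
   [x2] are at most [y + 1]. *)
pose h0 := Num.min (Num.min h1 d) (Num.min ((2 * pi - a) / (y + 1)) ((2 * pi - b) / (y + 1))).
have h00 : 0 < h0 by rewrite !lt_min h10 d0 !ang0.
pose eta : R := d / 4.
have eta0 : 0 < eta by rewrite divr_gt0.
have eta3 : eta < 1 / 3 by rewrite /eta; clear -d0 d1; lra.
suff int : (\int[(@lebesgue_measure R \x @lebesgue_measure R)%E]_(t in @torus_dom R)
    ratio_sq q p t = +oo)%E.
  by rewrite int ltxx in intq.
apply: (@integral_eq_pinfty_of_inverse_square R _ _ a b y eta h0 (e ^+ 2)) => //.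
- by apply: measurableX; exact: measurable_itv.
- by move=> t _; rewrite lee_fin sqr_ge0.
- by rewrite exprn_gt0.
move=> h x1 x2 /andP[hgt0]; rewrite !lt_min => /andP[/andP[hh1 hd] /andP[ha hb]].
rewrite !ltr_distl => /andP[x11 x12] /andP[x21 x22].
have y1 : 1 <= y by rewrite ler1n.
have ax1 : `|x1| <= y + 1 by rewrite ler_norml; move: x11 x12; rewrite /eta; clear -y1 d0 d1; lra.
have ax2 : `|x2| <= y + 1 by rewrite ler_norml; move: x21 x22; rewrite /eta; clear -y1 d0 d1; lra.
have hx (t x : R) : h < (2 * pi - t) / (y + 1) -> 0 <= t -> 0 <= x -> `|x| <= y + 1 ->
    0 <= t + h * x <= 2 * pi.
  rewrite ltr_pdivlMr// => ht t0 x0 xy; apply/andP; split.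
    by rewrite addr_ge0// mulr_ge0// ltW.
  have : h * x <= h * (y + 1) by rewrite ler_pM2l// (le_trans (ler_norm _)).
  clear -ht; lra.
split.
  split=> /=; rewrite in_itv /=; apply: hx => //.
    by move: x11; rewrite /eta; clear -d1; lra.
  by move: x21; rewrite /eta; clear -d1 y1; lra.
have hh : 0 < h < h1 by rewrite hgt0.
have [w1 E1 W1] := arc a h x1 hh ax1.
have [w2 E2 W2] := arc b h x2 hh ax2.
rewrite /ratio_sq /= E1 E2 -aE -bE lee_fin.
set r : C := _ * h%:C%C.
have nr : `|r| = h%:C%C.
  by rewrite normrM !normc_def /= !expr0n expr1n /= add0r addr0 sqrtr1 mul1r sqrtr_sqr gtr0_norm.
have rlt (s : R) : d <= s -> `|r| < s%:C%C by move=> ds; rewrite nr ltcR (lt_le_trans hd).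
have near0 l w (x x0 : R) : on_circle l -> `|w - x%:C%C| < (d / 2)%:C%C ->
    x0 - eta < x -> x < x0 + eta -> `|l * w - l * x0%:C%C| < d%:C%C.
  move=> cl wx xl xr; rewrite -mulrBr normrM (normr_on_circle _ cl) mul1r.
  have -> : w - x0%:C%C = (w - x%:C%C) + (x - x0)%:C%C by rewrite rmorphB /=; ring.
  apply: (le_lt_trans (ler_normD _ _)).
  have -> : d%:C%C = (d / 2)%:C%C + (d / 2)%:C%C by rewrite -rmorphD /= -splitr.
  apply: ltr_leD => //.
  rewrite normc_def /= expr0n /= addr0 sqrtr_sqr lecR ler_norml.
  by move: xl xr; rewrite /eta; clear -d0; lra.
have N1 : `|l1 * w1 - l1| < d%:C%C.
  by have := near0 _ _ _ 1 cl1 W1 x11 x12; rewrite rmorph1 mulr1.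
have N2 := near0 _ _ _ _ cl2 W2 x21 x22.
have dle (s : R) : d <= s -> d%:C%C <= s%:C%C :> C by rewrite lecR.
have Lp : kp * `|r| ^+ M <= `|peval2 p (l1 + r * (l1 * w1)) (l2 + r * (l2 * w2))|.
  by apply: lowp; rewrite dpE ?rlt//; apply: lt_le_trans (dle _ ddp).
have Lq : kq * `|r| ^+ k <= `|peval2 q (l1 + r * (l1 * w1)) (l2 + r * (l2 * w2))|.
  by apply: lowq; rewrite dqE ?rlt//; apply: lt_le_trans (dle _ ddq).
have Wn l w (x0 : R) : on_circle l -> 0 <= x0 -> x0 <= y -> `|l * w - l * x0%:C%C| < d%:C%C ->
    `|l * w| <= (y + 2)%:C%C.
  move=> cl x00 x0y lw; rewrite -(subrK (l * x0%:C%C) (l * w)).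
  apply: (le_trans (ler_normD _ _)).
  apply: (@le_trans _ _ (d%:C%C + x0%:C%C)).
    apply: lerD; first exact: ltW.
    by rewrite normrM (normr_on_circle _ cl) mul1r normc_def /= expr0n /= addr0 sqrtr_sqr
      lecR ger0_norm.
  by rewrite -rmorphD /= lecR; clear -d1 x0y; lra.
have Up : `|peval2 p (l1 + r * (l1 * w1)) (l2 + r * (l2 * w2))| <= B * `|r| ^+ M.
  apply: up.
  - by rewrite nr -[1](rmorph1 (real_complex R)) lecR; clear -hd d1; lra.
  - by apply: (Wn _ _ 1) => //; rewrite rmorph1 mulr1.
  - by apply: (Wn _ _ y) => //; exact: ltW.
set P := peval2 p _ _ in Lp Up *; set Q := peval2 q _ _ in Lq *.
have r0 : 0 < `|r| by rewrite nr ltcR.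
have P0 : 0 < `|P| by apply: lt_le_trans Lp; rewrite mulr_gt0// exprn_gt0.
suff : e / h <= cabs Q / cabs P.
  move=> le; rewrite (_ : e ^+ 2 / h ^+ 2 = (e / h) ^+ 2); last by rewrite expr_div_n.
  by rewrite ler_pXn2r// nnegrE divr_ge0 ?sqrtr_ge0 ?(ltW e0) ?(ltW hgt0).
have cP0 : 0 < cabs P by move: P0; rewrite normC_cabs ltcR.
rewrite ler_pdivlMr// mulrAC ler_pdivrMr// -lecR !rmorphM /= -!normC_cabs -eE -nr.
rewrite mulrAC ler_pdivrMr ?ltr_wpDl//.
apply: (@le_trans _ _ (kq * ((B + 1) * `|r| ^+ M))).
  rewrite ler_pM2l//; apply: (le_trans Up).
  by rewrite ler_wpM2r ?exprn_ge0// lerDl ler01.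
rewrite mulrCA [leRHS]mulrC; apply: ler_wpM2l; first by rewrite addr_ge0.
(* Here [k < M] enters: [|r| ^+ M <= |r| ^+ k.+1] because [|r| <= 1]. *)
apply: (@le_trans _ _ (kq * `|r| ^+ k * `|r|)); last by rewrite ler_wpM2r.
rewrite -mulrA -exprSr ler_pM2l// ler_wiXn2l//.
by rewrite nr -[1](rmorph1 (real_complex R)) lecR; clear -hd d1; lra.
Qed.

End Main.

Theorem theorem14p10 (R : realType) (p q : {poly {poly R[i]}}) :
  semi_stable p -> Ip p q ->
  (forall l1 l2 : R[i], on_circle l1 -> on_circle l2 ->
     nt_bounded (fun z1 z2 => peval2 q z1 z2 / peval2 p z1 z2) l1 l2) /\
  (forall (l1 l2 : R[i]) (M : nat), on_circle l1 -> on_circle l2 ->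
     vanishes_order p l1 l2 M -> vanishes_at_least q l1 l2 M).
Proof.
move=> [pD _] pq; split=> [l1 l2 cl1 cl2|l1 l2 M cl1 cl2 pM]; last first.
  exact: vanishes_of_Ip pM.
have d0 : in_disk (0 : R[i]) by rewrite /in_disk /cabs /= expr0n addr0 sqrtr0.
(* Since [p] is nonzero at the origin, it has a finite order of vanishing at every point, possibly
   [0]. *)
have [M pM] := exists_vanishes_order_of_neq0 _ _ l1 l2 _ _ (pD 0 0 d0 d0).
apply: (nt_bounded_of_vanishes _ _ _ _ _ _ pD cl1 cl2 pM).
exact: vanishes_of_Ip pM.
Qed.
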